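(* Let $0<p\le1/2$ and let $X_j$, $j\in\mathbb{N}_0$, be independent Bernoulli random variables with parameter $p$; put $X_{-1}=0$. For $k,n\in\mathbb{N}$ with $k\le n$ let $$ S_{n,k}=\sum_{i=0}^{n-k}I^{(i)},\qquad I^{(i)}=\mathbf{1}\{X_{i-1}=0,X_i=1,\dots,X_{i+k-1}=1\}. $$ Then for all $k,n\in\mathbb{N}$ with $k\le n$, $$ d_{TV}\big(S_{n,k},P_{\mathbb{E}[S_{n,k}]}\big)\le(2k+1)\big(1\wedge\mathbb{E}[S_{n,k}]\big)p^k. $$ Moreover, for all $v\in\mathbb{N}_0$ and $n\ge2$, $$ \max_{1\le k\le n}\big|\mathbb{P}(S_{n,k}\le v)-\mathbb{P}(P_{\mathbb{E}[S_{n,k}]}\le v)\big|\le40(v+2)^2\frac{\log n}{n}. $$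
   Context: $\mathbb{N}=\{1,2,\dots\}$, $\mathbb{N}_0=\mathbb{N}\cup\{0\}$, $a\wedge b=\min\{a,b\}$, $\log$ is the natural logarithm. The indicators $I^{(i)}$ depend on $k$. $P_\alpha$ denotes a Poisson random variable with mean $\alpha$. $d_{TV}(X,X')=\sup_{A\subset\mathbb{N}_0}|\mathbb{P}(X\in A)-\mathbb{P}(X'\in A)|$ for $\mathbb{N}_0$-valued random variables. *)

(* Defs.v *)
From HB Require Import structures.
From mathcomp Require Import all_boot all_order all_algebra finmap.
From mathcomp Require Import all_classical all_reals all_analysis.

Set Implicit Arguments.
Unset Strict Implicit.
Unset Printing Implicit Defensive.

Import Order.TTheory GRing.Theory Num.Theory.
Import numFieldNormedType.Exports.

Local Open Scope classical_set_scope.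
Local Open Scope ring_scope.

Definition mutually_independent (d d' : measure_display)
    (T : measurableType d) (T' : measurableType d') (R : realType)
    (P : probability T R) (I : choiceType) (X : I -> {RV P >-> T'}) : Prop :=
  forall (J : {fset I}) (A : I -> set T'), (forall j, measurable (A j)) ->
    P (\bigcap_(j in [set` J]) (X j @^-1` A j)) =
    (\prod_(j <- J) P (X j @^-1` A j))%E.

(* The second argument of [poisson_prob] is unused in the library's
   definition, so its value is irrelevant. *)
Definition poisson_law (R : realType) (a : R) : probability nat R :=
  poisson_prob a 0%N.

(* The total variation distance of two nat-valued random variables, as a
   function of their laws; every subset of nat is measurable. *)
Definition dTV (R : realType) (mu nu : probability nat R) : R :=
  sup [set `|fine (mu A) - fine (nu A)| | A in [set: set nat]].

Section runs.
Context (d : measure_display) (T : measurableType d).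
Implicit Types (X : nat -> {mfun T >-> bool}) (i k n : nat).

(* [previous X i] is X_{i-1}, with the convention X_{-1} = 0. *)
Definition previous X i (w : T) : bool :=
  if i is j.+1 then X j w else false.

Definition run_at X k i (w : T) : bool :=
  ~~ previous X i w && [forall l : 'I_k, X (i + l)%N w].

Definition run_count X n k (w : T) : nat :=
  (\sum_(0 <= i < (n - k).+1) run_at X k i w)%N.

Lemma measurable_run_at X k i : measurable [set w | run_at X k i w].
Proof.
have mX j : measurable [set w | X j w].
  have := @measurable_funPTI _ _ _ _ (X j) [set true] I.
  by congr measurable; apply/seteqP; split=> w /=.
rewrite (_ : [set w | _] = ~` [set w | previous X i w] `&`
    \bigcap_(l in [set: 'I_k]) [set w | X (i + l)%N w]); last first.
  apply/seteqP; split=> w /=.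
    by move=> /andP[/negP ? /forallP h]; split=> // l _ /=; exact: h.
  by move=> [/negP ? h]; apply/andP; split=> //; apply/forallP => l; exact: h.
apply: measurableI.
  apply: measurableC; case: i => [|i]; last exact: mX.
  by rewrite (_ : [set w | _] = set0)//; apply/seteqP; split.
by apply: fin_bigcap_measurable => // l _; exact: mX.
Qed.

Lemma measurable_run_count X n k : measurable_fun [set: T] (run_count X n k).
Proof.
rewrite /run_count; elim: (n - k).+1 => [|m IH].
  by under eq_fun do rewrite big_nil; exact: measurable_cst.
under eq_fun do rewrite big_nat_recr//=.
move=> _ B _; rewrite setTI.
pose f w := (\sum_(0 <= i < m) run_at X k i w)%N.
rewrite (_ : _ @^-1` B =
  ([set w | run_at X k m w] `&` f @^-1` [set x | B (x + 1)%N]) `|`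
  (~` [set w | run_at X k m w] `&` f @^-1` [set x | B x])); last first.
  apply/seteqP; split=> w /=; rewrite -/(f w).
    case: (run_at X k m w) => h; [by left|right; split=> //].
    by move: h; rewrite addn0.
  by case: (run_at X k m w) => [] [[? ?]|[? ?]] //; rewrite addn0.
have mf C : measurable (f @^-1` C) by rewrite -[X in measurable X]setTI; exact: IH.
apply: measurableU; apply: measurableI => //; last apply: measurableC;
  exact: measurable_run_at.
Qed.

HB.instance Definition _ X n k :=
  isMeasurableFun.Build _ _ _ _ (run_count X n k) (measurable_run_count X n k).

End runs.

Definition run_mean (d : measure_display) (T : measurableType d)
    (R : realType) (P : probability T R) (X : nat -> {RV P >-> bool})
    (n k : nat) : R :=
  fine 'E_P[fun w => (run_count X n k w)%:R].

(* Main.v *)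
Require Import Defs.
From HB Require Import structures.
From mathcomp Require Import all_boot all_order all_algebra finmap.
From mathcomp Require Import all_classical all_reals all_analysis.
From mathcomp Require Import measurable_realfun zify ring lra.

(** Two runs whose starting points are at distance at most [k] exclude each
    other: the later one needs a failure just before it, at a place where the
    earlier one needs a success. Runs starting further apart read disjoint
    sets of letters and are independent. For indicators [I_i] with this
    structure, the Chen-Stein method needs very little. Let [l = E S], and let
    [g] solve the Stein equation
      [l * g (s + 1) - s * g s = 1_A s - Po(l) A].
    On the event [I_i = 1] all other indicators near [i] vanish, so that
    [S = W_i + 1], where [W_i] counts the runs far from [i] and is independent
    of [I_i]. Summing over [i] gives ([stein_expectation])
      [P (S in A) - Po(l) A = sum_i p_i * E (g (S + 1) - g (W_i + 1))].

    Here [S - W_i] counts runs among at most [2k + 1] positions, each of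
    probability at most [p^k], and the increments of [g] are at most
    [min 1 (1/l)] ([stein_increment]); the total variation bound follows.

    For the second part, [p^k] is at most about [l / n] and only [k] up to order
    [log n] matters (for larger [k] the factor [p^k] alone is small enough),
    so the first bound is good enough as long as [l <= (v + 2)^2]. For
    larger means it is too weak by a factor [l], which is recovered from the
    shape of [g] when [A = {0, .., v}]: it rises up to [v + 1], where its
    height is of order [1/l], and from [v + 2] on it stays below
    [(v + 1) / l] times that height. Hence [g (S + 1) - g (W_i + 1)] is of
    order [1/l] only if [W_i <= v], which by Chebyshev's inequality has
    probability of order [1/l], even given that some run starts near [i].
    This gives an error of order [(v + 2) * k * p^k / l]
    ([run_count_poisson_half_line]), and [p^k / l <= 4 / n].

    All the events depend on the first [n] letters only, so the computations
    take place on the finite set of words of length [n] with product weights,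
    to which the probability space of the theorem is mapped. *)

Import Order.TTheory GRing.Theory Num.Theory.
Import numFieldNormedType.Exports.

Local Open Scope classical_set_scope.
Local Open Scope ring_scope.

(** * Poisson weights and their partial sums *)

Section poisson_masses.
Context {R : realType}.
Implicit Types (l : R) (A : set nat) (i j s v : nat).

Definition poisson_cdf l j : R := \sum_(i < j) poisson_pmf l i.

Definition poisson_mass_below l A j : R :=
  \sum_(i < j) (val i \in A)%:R * poisson_pmf l i.

Lemma poisson_pmf_gt0 l j : 0 < l -> 0 < poisson_pmf l j.
Proof.
by move=> l0; rewrite /poisson_pmf l0 mulr_gt0 ?expR_gt0 ?divr_gt0 ?exprn_gt0.
Qed.

(** The detailed balance behind the Stein equation: the Poisson law is
    stationary for births at rate [l] and deaths at rate [j]. *)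
Lemma poisson_pmfS l j : 0 < l ->
  j.+1%:R * poisson_pmf l j.+1 = l * poisson_pmf l j.
Proof.
move=> l0; rewrite /poisson_pmf l0 factS natrM exprS.
have f0 : (j`!%:R : R) != 0 by rewrite pnatr_eq0 -lt0n fact_gt0.
by field; rewrite f0 /= -[X in X + _]/(1%:R) -natrD pnatr_eq0.
Qed.

Lemma poisson_cdfS l j : poisson_cdf l j.+1 = poisson_cdf l j + poisson_pmf l j.
Proof. by rewrite /poisson_cdf big_ord_recr. Qed.

Lemma poisson_cdf_cvg l : 0 < l -> poisson_cdf l @ \oo --> (1 : R).
Proof.
move=> l0.
have -> : poisson_cdf l = (fun m => expR (- l) * series (exp_coeff l) m).
  apply/funext => m; rewrite /poisson_cdf /series/= big_mkord mulr_sumr.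
  by apply: eq_bigr => i _; rewrite /poisson_pmf l0 /exp_coeff/= mulrC.
have -> : (1 : R) = expR (- l) * expR l by rewrite -expRD addNr expR0.
apply: cvgMr; rewrite /expR.
exact: is_cvg_series_exp_coeff.
Qed.

Lemma poisson_law_split l A j : 0 < l ->
  fine (poisson_law l A) = poisson_mass_below l A j
    + fine (poisson_law l (A `&` [set i | (j <= i)%N])).
Proof.
move=> l0; elim: j => [|j IH].
  rewrite /poisson_mass_below big_ord0 add0r; congr (fine (_ _)).
  by apply/seteqP; split=> i // [].
rewrite IH /poisson_mass_below big_ord_recr/= -addrA; congr (_ + _).
have [jA|jA] := boolP (j \in A); last first.
  rewrite mul0r add0r; congr (fine (_ _)).
  apply/seteqP; split=> i /= [Ai ji]; split=> //; last exact: ltnW.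
  by rewrite ltn_neqAle ji andbT; apply: contraNN jA => /eqP ->; exact/mem_set.
rewrite mul1r.
have -> : A `&` [set i | (j <= i)%N] =
    [set j] `|` (A `&` [set i | (j < i)%N]).
  apply/seteqP; split=> i /= => [[Ai]|[->|[Ai ji]]].
  - by rewrite leq_eqVlt => /orP[/eqP ->|ji]; [left|right].
  - by split=> //; exact: set_mem.
  - by split=> //; exact: ltnW.
rewrite measureU//; last by apply/seteqP; split=> i //= [->] [_]; rewrite ltnn.
rewrite fineD ?fin_num_measure//; congr (_ + _).
by rewrite /= /poisson_prob l0 esum_set1// lee_fin poisson_pmf_ge0.
Qed.

Lemma poisson_mass_belowT l j : poisson_mass_below l setT j = poisson_cdf l j.
Proof. by apply: eq_bigr => i _; rewrite in_setT mul1r. Qed.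

(** The mass of [A] from [j] on is written as a difference, so that infinite sums
    never enter the algebra of the Stein solution. *)
Lemma poisson_mass_above_ge0 l A j : 0 < l ->
  0 <= fine (poisson_law l A) - poisson_mass_below l A j.
Proof.
by move=> l0; rewrite (poisson_law_split l A j l0) addrC addKr fine_ge0.
Qed.

Lemma poisson_mass_above_le l A j : 0 < l ->
  fine (poisson_law l A) - poisson_mass_below l A j <= 1 - poisson_cdf l j.
Proof.
move=> l0; rewrite (poisson_law_split l A j l0) addrC addKr.
have := poisson_law_split l setT j l0; rewrite poisson_mass_belowT.
have -> : fine (poisson_law l [set: nat]) = 1 by rewrite probability_setT.
move=> ->; rewrite [leRHS]addrC addKr.
rewrite fine_le ?fin_num_measure//; apply: le_measure; rewrite ?inE//.
exact: setSI.
Qed.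

Lemma poisson_mass_below_ge0 l A j : 0 < l -> 0 <= poisson_mass_below l A j.
Proof.
by move=> l0; apply: sumr_ge0 => i _; rewrite mulr_ge0// ltW// poisson_pmf_gt0.
Qed.

Lemma poisson_mass_below_le l A j : 0 < l ->
  poisson_mass_below l A j <= poisson_cdf l j.
Proof.
move=> l0; apply: ler_sum => i _; apply: ler_piMl.
  exact/ltW/poisson_pmf_gt0.
by rewrite lern1 leq_b1.
Qed.

(** Balance turns [l * pmf i] into [i.+1 * pmf i.+1], and [i.+1 <= j] for
    [i < j]. With [poisson_tail_ratio], this is all that is used of the Poisson
    law to bound and compare values of the Stein solution. *)
Lemma poisson_cdf_ratio l j : 0 < l ->
  l * poisson_cdf l j <= j%:R * (poisson_cdf l j.+1 - poisson_pmf l 0).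
Proof.
move=> l0; rewrite /poisson_cdf [X in _ * (X - _)]big_ord_recl/= addrC addKr.
rewrite !mulr_sumr; apply: ler_sum => i _.
rewrite -poisson_pmfS// ler_wpM2r ?poisson_pmf_ge0// ler_nat.
exact: ltn_ord.
Qed.

(** The mirror image of [poisson_cdf_ratio] for the upper tail, obtained as the
    limit of the corresponding inequality between finite blocks. *)
Lemma poisson_tail_ratio l j : 0 < l ->
  j%:R * (1 - poisson_cdf l j.+1) <= l * (1 - poisson_cdf l j).
Proof.
move=> l0.
have cdf_le1 m : poisson_cdf l m <= 1.
  have := poisson_mass_above_ge0 l setT m l0.
  by rewrite probability_setT poisson_mass_belowT subr_ge0.
have step m : j%:R * (poisson_cdf l (m + j.+1)%N - poisson_cdf l j.+1) <=
    l * (poisson_cdf l (m + j)%N - poisson_cdf l j).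
  elim: m => [|m IH]; first by rewrite !add0n !subrr !mulr0.
  rewrite !addSn !poisson_cdfS addnS in IH *.
  have := poisson_pmfS l (m + j)%N l0.
  have : j%:R * poisson_pmf l (m + j).+1 <=
         (m + j).+1%:R * poisson_pmf l (m + j).+1.
    rewrite ler_wpM2r ?poisson_pmf_ge0// ler_nat ltnW// ltnS.
    exact: leq_addl.
  move: IH; rewrite !poisson_cdfS; lra.
have cvgU : (fun m => j%:R * (poisson_cdf l (m + j.+1)%N - poisson_cdf l j.+1))
    @ \oo --> j%:R * (1 - poisson_cdf l j.+1).
  apply: cvgMr; apply: cvgB; last exact: cvg_cst.
  by rewrite (cvg_shiftn j.+1 (poisson_cdf l)); exact: poisson_cdf_cvg.
rewrite -(cvg_lim _ cvgU)//; apply: limr_le; first exact: cvgP cvgU.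
near=> m; apply: le_trans (step m) _.
by rewrite ler_pM2l// lerD2r cdf_le1.
Unshelve. all: by end_near. Qed.

End poisson_masses.

(** * The Stein equation and the increments of its solution *)

Section stein_solution.
Context {R : realType}.
Implicit Types (l : R) (A : set nat) (i j s v : nat).

(** The bounded solution of [l * g s.+1 - s * g s = 1_A s - Po(l) A]; division by
    zero makes it [0] at [0]. *)
Definition stein_solution l A j : R :=
  (poisson_mass_below l A j - fine (poisson_law l A) * poisson_cdf l j) /
  (j%:R * poisson_pmf l j).

Lemma stein_equation l A s : 0 < l ->
  l * stein_solution l A s.+1 - s%:R * stein_solution l A s =
  (s \in A)%:R - fine (poisson_law l A).
Proof.
move=> l0; rewrite /stein_solution poisson_pmfS//.
have p0 := poisson_pmf_gt0 l s l0.
rewrite poisson_cdfS /poisson_mass_below big_ord_recr/=.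
rewrite -/(poisson_mass_below l A s).
have [->|s0] := eqVneq s 0%N.
  rewrite /poisson_cdf /poisson_mass_below !big_ord0 mul0r subr0 !add0r.
  by field; rewrite !gt_eqF// poisson_pmf_gt0.
by field; rewrite !gt_eqF// ltr0n lt0n.
Qed.

(** Up to a positive factor, the increment of the solution at [j] is a
    combination of the masses [a], [b], [c] that [A] has below, at and above [j].
    The ratio inequalities make the coefficients of [a] and [c] nonpositive, so
    only the mass at [j] itself can make the increment positive. *)
Lemma stein_increment_numerator_le (a b c u q t l j q0 : R) :
  0 <= a -> 0 <= b <= q -> 0 <= c -> u + q + t = 1 -> 0 <= j -> 0 <= q0 ->
  j * t <= l * (1 - u) -> l * u <= j * (u + q - q0) -> 0 <= l * u -> 0 <= t ->
  a * (j * t - l * (1 - u)) + b * (j * t + l * u) + c * (l * u - j * (u + q))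
    <= q * (j * (1 - q0)).
Proof.
move=> a0 /andP[b0 bq] c0 uqt j0 q00 jt lu lu0 t0.
have : a * (j * t - l * (1 - u)) <= 0 by rewrite mulr_ge0_le0// subr_le0.
have : c * (l * u - j * (u + q)) <= 0.
  rewrite mulr_ge0_le0// subr_le0 (le_trans lu)// ler_wpM2l//.
  by rewrite lerBlDr lerDl.
have : b * (j * t + l * u) <= q * (j * (1 - q0)).
  apply: le_trans (_ : q * (j * t + l * u) <= _).
    by rewrite ler_wpM2r// addr_ge0// mulr_ge0.
  rewrite ler_wpM2l//; first exact: le_trans bq.
  have -> : t = 1 - u - q by rewrite -uqt; ring.
  lra.
lra.
Qed.

(** An upper bound suffices, since passing to the complement of [A] changes the
    sign of the solution. It comes out as [(1 - exp (- l)) / l], which is at most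
    both [1] and [1 / l]. *)
Lemma stein_increment l A j : 0 < l -> (0 < j)%N ->
  `|stein_solution l A j.+1 - stein_solution l A j| <=
  Num.min 1 (l^-1).
Proof.
move=> l0 j0; have pj := poisson_pmf_gt0 l j l0.
have j0R : 0 < j%:R :> R by rewrite ltr0n.
set q := poisson_pmf l j in pj *.
pose q0 := expR (- l).
have pmf0 : poisson_pmf l 0 = q0.
  by rewrite /poisson_pmf l0 expr0 fact0 invr1 !mul1r.
pose a := poisson_mass_below l A j; pose b := (j \in A)%:R * q.
pose al := fine (poisson_law l A); pose u := poisson_cdf l j.
have mS : poisson_mass_below l A j.+1 = a + b.
  by rewrite /poisson_mass_below big_ord_recr.
have cS : poisson_cdf l j.+1 = u + q by rewrite poisson_cdfS.
have c0 : 0 <= al - (a + b) by rewrite -mS poisson_mass_above_ge0.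
have ct : al - (a + b) <= 1 - (u + q).
  by rewrite -mS -cS poisson_mass_above_le.
have a0 : 0 <= a by exact: poisson_mass_below_ge0.
have au : a <= u by exact: poisson_mass_below_le.
have bq : 0 <= b <= q.
  by rewrite /b; case: (_ \in _); rewrite ?mul1r ?mul0r lexx (ltW pj).
have tail := poisson_tail_ratio l j l0; rewrite cS -/u in tail.
have head := poisson_cdf_ratio l j l0; rewrite cS -/u pmf0 in head.
have q00 : 0 <= q0 by exact: expR_ge0.
have lu0 : 0 <= l * u by apply: mulr_ge0; [exact: ltW|exact: le_trans au].
pose D := a * (j%:R * (1 - (u + q)) - l * (1 - u)) +
  b * (j%:R * (1 - (u + q)) + l * u) +
  (al - (a + b)) * (l * u - j%:R * (u + q)).
have DE : stein_solution l A j.+1 - stein_solution l A j =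
    D / (l * (j%:R * q)).
  rewrite /stein_solution poisson_pmfS// mS cS -/a -/al -/u -/q /D.
  by field; rewrite !gt_eqF.
have Dub : `|D| <= q * (j%:R * (1 - q0)).
  rewrite ler_norml; apply/andP; split; last first.
    by apply: stein_increment_numerator_le => //; lra.
  (* complementing A changes the sign of the increment *)
  have -> : D = - ((u - a) * (j%:R * (1 - (u + q)) - l * (1 - u)) +
    (q - b) * (j%:R * (1 - (u + q)) + l * u) +
    (1 - (u + q) - (al - (a + b))) * (l * u - j%:R * (u + q))).
    by rewrite /D; ring.
  rewrite lerN2; by apply: stein_increment_numerator_le => //; lra.
rewrite DE normrM [X in _ * X]gtr0_norm ?invr_gt0 ?mulr_gt0//.
rewrite ler_pdivrMr ?mulr_gt0//; apply: le_trans Dub _.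
rewrite minr_pMl; last by rewrite ltW// !mulr_gt0.
have q01 : q0 <= 1 by rewrite /q0 expR_le1; lra.
have q0l : 1 - q0 <= l by have := expR_ge1Dx (- l); rewrite -/q0; lra.
have qj : 0 < q * j%:R by rewrite mulr_gt0.
rewrite le_min; apply/andP; split.
  have -> : 1 * (l * (j%:R * q)) = q * j%:R * l by ring.
  by rewrite mulrA ler_pM2l.
rewrite mulKf ?gt_eqF// mulrA [q * _]mulrC.
by rewrite -[leRHS]mulr1 ler_pM2l ?lerBlDr ?lerDl// mulr_gt0.
Qed.

End stein_solution.

(** * The Stein solution of a half-line *)

Section stein_half_line.
Context {R : realType}.
Context (l : R) (v : nat) (l0 : 0 < l).

Let A : set nat := [set j | (j <= v)%N].
Let g := stein_solution l A.
Let al := fine (poisson_law l A).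

Let al_ge0 : 0 <= al.
Proof. by rewrite fine_ge0. Qed.

Let al_le1 : al <= 1.
Proof.
have := poisson_mass_above_le l A 0 l0.
by rewrite /poisson_mass_below /poisson_cdf !big_ord0 !subr0.
Qed.

Let denom_gt0 j : 0 < j.+1%:R * poisson_pmf l j.+1.
Proof. by rewrite mulr_gt0// poisson_pmf_gt0. Qed.

(* Below the peak [A] fills everything, beyond it [A] is exhausted: the
   solution reduces to a ratio of the cumulative, respectively tail, mass to
   the weight at [j]. Both ratios are monotone. *)
Let g_head j : (j <= v.+1)%N ->
  g j = (1 - al) * poisson_cdf l j / (j%:R * poisson_pmf l j).
Proof.
move=> jv; rewrite /g /stein_solution -/al; congr (_ / _).
suff -> : poisson_mass_below l A j = poisson_cdf l j by ring.
apply: eq_bigr => i _; rewrite (_ : val i \in A) ?mul1r//.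
by apply/mem_set; rewrite /A/= -ltnS; exact: leq_trans (ltn_ord i) jv.
Qed.

Let g_tail j : (v < j)%N ->
  g j = al * (1 - poisson_cdf l j) / (j%:R * poisson_pmf l j).
Proof.
move=> vj; rewrite /g /stein_solution -/al; congr (_ / _).
suff -> : poisson_mass_below l A j = al by ring.
rewrite /al (poisson_law_split l A j l0).
rewrite (_ : A `&` _ = set0) ?measure0 ?addr0//.
apply/seteqP; split=> i // [iv ji].
by have := leq_trans (leq_trans vj ji) iv; rewrite ltnn.
Qed.

Let cdf_ge0 j : 0 <= poisson_cdf l j.
Proof. by apply: sumr_ge0 => i _; exact: poisson_pmf_ge0. Qed.

Let g0 : g 0%N = 0.
Proof. by rewrite /g /stein_solution mul0r invr0 mulr0. Qed.

Lemma stein_half_line_ge0 j : 0 <= g j.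
Proof.
case: j => [|j]; first by rewrite g0.
have [jv|vj] := leqP j.+1 v.+1.
  rewrite g_head// divr_ge0 ?mulr_ge0 ?subr_ge0//; exact: poisson_pmf_ge0.
rewrite g_tail ?(ltnW vj)// divr_ge0 ?mulr_ge0 ?poisson_pmf_ge0//.
rewrite -(poisson_mass_belowT l) -[1](_ : fine (poisson_law l [set: nat]) = 1).
  exact: poisson_mass_above_ge0.
by rewrite probability_setT.
Qed.

Let g_up j : (j <= v)%N -> g j <= g j.+1.
Proof.
case: j => [|j] jv; first by rewrite g0 stein_half_line_ge0.
rewrite !g_head ?(leqW jv)// [j.+2%:R * _]poisson_pmfS//.
rewrite -!mulrA ler_wpM2l ?subr_ge0//.
have q0 := poisson_pmf_gt0 l j.+1 l0.
rewrite !invfM !mulrA ler_wpM2r ?invr_ge0 ?(ltW q0)//.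
rewrite ler_pdivrMr// mulrAC ler_pdivlMr// mulrC [leRHS]mulrC.
apply: le_trans (poisson_cdf_ratio l j.+1 l0) _.
by rewrite ler_wpM2l// lerBlDr lerDl poisson_pmf_ge0.
Qed.

Let g_down j : (v < j)%N -> g j.+1 <= g j.
Proof.
case: j => [//|j] vj.
rewrite !g_tail ?(leqW vj)// [j.+2%:R * _]poisson_pmfS//.
rewrite -!mulrA ler_wpM2l//.
have q0 := poisson_pmf_gt0 l j.+1 l0.
rewrite !invfM !mulrA ler_wpM2r ?invr_ge0 ?(ltW q0)//.
rewrite ler_pdivlMr// mulrAC ler_pdivrMr// mulrC [leRHS]mulrC.
exact: poisson_tail_ratio.
Qed.

Let g_tail_le m d : (v < m)%N -> g (m + d)%N <= g m.
Proof.
move=> vm; elim: d => [|d IH]; first by rewrite addn0.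
rewrite addnS; apply: le_trans IH; apply: g_down.
exact: leq_trans vm (leq_addr _ _).
Qed.

Lemma stein_half_line_le_peak j : g j <= g v.+1.
Proof.
have [jv|/ltnW vj] := leqP j v.+1; last first.
  by rewrite -(subnKC vj) g_tail_le.
have up m : (m <= v.+1)%N -> forall i, (i <= m)%N -> g i <= g m.
  elim: m => [|m IH] mv i; first by rewrite leqn0 => /eqP ->.
  rewrite leq_eqVlt => /orP[/eqP ->//|im].
  exact: le_trans (IH (ltnW mv) _ im) (g_up _ mv).
exact: up.
Qed.

Lemma stein_half_line_le_beyond j : (v.+1 < j)%N -> g j <= g v.+2.
Proof. by move=> vj; rewrite -(subnKC vj) g_tail_le. Qed.

(** The Stein equation at [v], where the solution is still nondecreasing, bounds
    its maximum. *)
Lemma stein_half_line_peak_le : (l - v%:R) * g v.+1 <= 1.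
Proof.
have := stein_equation l A v l0; rewrite mem_set; last exact: leqnn.
rewrite -/al -/g /= => e.
have := ler_wpM2l (ler0n R v) (stein_half_line_le_peak v).
move: e al_ge0; rewrite mulrBl; lra.
Qed.

(** The Stein equation at [v + 1], which lies outside [A]: one step after the
    peak the solution has dropped by a factor of order [l]. *)
Lemma stein_half_line_beyond_le : l * g v.+2 <= v.+1%:R * g v.+1.
Proof.
have := stein_equation l A v.+1 l0; rewrite memNset; last by rewrite /A/= ltnn.
rewrite -/al -/g /= => e.
move: e al_ge0; lra.
Qed.

End stein_half_line.

(** * Expectations over a finite weighted set *)

Section expectation.
Context {R : realFieldType} {Om : finType}.
Implicit Types (w f h : Om -> R).

Definition expect w f : R := \sum_x w x * f x.

Lemma eq_expect w f h : f =1 h -> expect w f = expect w h.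
Proof. by move=> fh; apply: eq_bigr => x _; rewrite fh. Qed.

Lemma expectZ w c f : expect w (fun x => c * f x) = c * expect w f.
Proof. by rewrite /expect mulr_sumr; apply: eq_bigr => x _; rewrite mulrCA. Qed.

Lemma expectB w f h :
  expect w (fun x => f x - h x) = expect w f - expect w h.
Proof. by rewrite /expect -sumrB; apply: eq_bigr => x _; rewrite mulrBr. Qed.

Lemma expectD w f h :
  expect w (fun x => f x + h x) = expect w f + expect w h.
Proof. by rewrite /expect -big_split; apply: eq_bigr => x _; rewrite mulrDr. Qed.

Lemma expect_cst w c : \sum_x w x = 1 -> expect w (fun=> c) = c.
Proof. by move=> w1; rewrite /expect -mulr_suml w1 mul1r. Qed.

Lemma expect_sum w (J : finType) (B : pred J) (F : J -> Om -> R) :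
  expect w (fun x => \sum_(j | B j) F j x) = \sum_(j | B j) expect w (F j).
Proof.
rewrite /expect exchange_big; apply: eq_bigr => x _.
by rewrite mulr_sumr.
Qed.

Lemma le_expect w f h : (forall x, 0 <= w x) -> (forall x, f x <= h x) ->
  expect w f <= expect w h.
Proof. by move=> w0 fh; apply: ler_sum => x _; rewrite ler_wpM2l. Qed.

Lemma ler_norm_expect w f : (forall x, 0 <= w x) ->
  `|expect w f| <= expect w (fun x => `|f x|).
Proof.
move=> w0; apply: le_trans (ler_norm_sum _ _ _) _.
by apply: ler_sum => x _; rewrite normrM ger0_norm.
Qed.

End expectation.

(** * The Chen-Stein method for mutually exclusive neighbours *)

Definition hits {Om J : finType} (I : J -> Om -> bool) (B : pred J) (x : Om) :=
  (\sum_(j | B j) I j x)%N.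

(** Indicators that exclude each other within a neighbourhood [nb] and are
    independent of the far ones. Independence is stated for functions of a count,
    the form in which the Stein identity and the second moment use it. *)
Record exclusive_dissociated {R : realFieldType} {Om J : finType} (w : Om -> R)
    (I : J -> Om -> bool) (nb : rel J) : Prop := ExclusiveDissociated {
  weight_ge0 : forall x, 0 <= w x;
  weight_sum1 : \sum_x w x = 1;
  nb_refl : reflexive nb;
  nb_exclusive : forall i j x, nb i j -> i != j -> ~~ (I i x && I j x);
  nb_indep : forall i (B : pred J) (f : nat -> R),
    (forall j, B j -> ~~ nb i j) ->
    expect w (fun x => (I i x)%:R * f (hits I B x)) =
    expect w (fun x => (I i x)%:R) * expect w (fun x => f (hits I B x)) }.

Arguments weight_ge0 {R Om J w I nb}.
Arguments weight_sum1 {R Om J w I nb}.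
Arguments nb_refl {R Om J w I nb}.
Arguments nb_exclusive {R Om J w I nb}.
Arguments nb_indep {R Om J w I nb}.

Section chen_stein.
Context {R : realFieldType} {Om J : finType} {w : Om -> R}.
Context {I : J -> Om -> bool} {nb : rel J}.
Context (dis : exclusive_dissociated w I nb).

Local Notation E := (expect w).
Local Notation pr i := (E (fun x => (I i x)%:R)).
Local Notation S := (hits I predT).
Local Notation W i := (hits I (fun j => ~~ nb i j)).
Local Notation V i j := (hits I (fun l => ~~ nb i l && ~~ nb j l)).

Let w0 := weight_ge0 dis.
Let w1 := weight_sum1 dis.

Lemma indicator_expect_ge0 i : 0 <= pr i.
Proof. by apply: sumr_ge0 => x _; rewrite mulr_ge0. Qed.

Lemma hitsE (B : pred J) x : (hits I B x)%:R = \sum_(j | B j) (I j x)%:R :> R.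
Proof. by rewrite /hits natr_sum. Qed.

Lemma expect_hits (B : pred J) :
  E (fun x => (hits I B x)%:R) = \sum_(j | B j) pr j.
Proof. by under eq_expect do rewrite hitsE; rewrite expect_sum. Qed.

Lemma hits_split i x : S x = (hits I (nb i) x + W i x)%N.
Proof. by rewrite /hits (bigID (nb i)). Qed.

(** Exclusion in quantitative form: an indicator that occurs is alone in its
    neighbourhood. *)
Lemma hits_nb_eq1 i x : I i x -> hits I (nb i) x = 1%N.
Proof.
move=> Ix; rewrite /hits (bigD1 i) ?(nb_refl dis)//= Ix big1 ?addn0// => j.
move=> /andP[nij ji]; have := nb_exclusive dis i j x nij.
by rewrite Ix eq_sym ji /= => /(_ isT)/negbTE ->.
Qed.

(** The core of the method. In [E (S * g S)] the factor [S] is expanded; each term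
    [I_i * g S] equals [I_i * g (W_i + 1)] by exclusion and then factors by
    independence. *)
Lemma stein_expectation (g : nat -> R) :
  E (fun x => (\sum_i pr i) * g (S x).+1 - (S x)%:R * g (S x)) =
  \sum_i pr i * E (fun x => g (S x).+1 - g (W i x).+1).
Proof.
rewrite expectB expectZ mulr_suml.
have -> : E (fun x => (S x)%:R * g (S x)) =
    \sum_i pr i * E (fun x => g (W i x).+1).
  have -> : E (fun x => (S x)%:R * g (S x)) =
      E (fun x => \sum_i (I i x)%:R * g (W i x).+1).
    apply: eq_expect => x; rewrite hitsE mulr_suml; apply: eq_bigr => i _.
    case: (boolP (I i x)) => [Ix|_]; last by rewrite !mul0r.
    by rewrite (hits_split i) hits_nb_eq1.
  rewrite expect_sum; apply: eq_bigr => i _.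
  exact: (nb_indep dis i (fun j => ~~ nb i j) (fun s => g s.+1)).
rewrite -sumrB; apply: eq_bigr => i _.
by rewrite expectB mulrBr.
Qed.

Lemma stein_bound (g h : nat -> R) (al : R) (D : J -> Om -> R) :
  (forall s, (\sum_i pr i) * g s.+1 - s%:R * g s = h s - al) ->
  (forall i x, `|g (S x).+1 - g (W i x).+1| <= D i x) ->
  `|E (fun x => h (S x)) - al| <= \sum_i pr i * E (D i).
Proof.
move=> gh gD; rewrite -[al](expect_cst w) ?w1// -expectB.
under eq_expect do rewrite -gh.
rewrite stein_expectation; apply: le_trans (ler_norm_sum _ _ _) _.
apply: ler_sum => i _; rewrite normrM ger0_norm ?indicator_expect_ge0//.
rewrite ler_wpM2l ?indicator_expect_ge0//.
apply: le_trans (ler_norm_expect _ _ w0) _.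
exact: le_expect.
Qed.

Lemma increments_le (g : nat -> R) (c : R) s d :
  (forall j, (0 < j)%N -> `|g j.+1 - g j| <= c) ->
  `|g (d + s).+1 - g s.+1| <= c * d%:R.
Proof.
move=> gc; elim: d => [|d IH]; first by rewrite subrr normr0 mulr0.
rewrite addSn -natr1 mulrDr mulr1 [leRHS]addrC.
apply: le_trans (ler_distD (g (d + s).+1) _ _) _.
by rewrite lerD// gc.
Qed.

(** If [c] bounds the increments of [g], each difference in [stein_expectation]
    is at most [c] times the number of neighbours of [i] that occur. *)
Lemma chen_stein_uniform (g h : nat -> R) (al c : R) :
  (forall s, (\sum_i pr i) * g s.+1 - s%:R * g s = h s - al) ->
  (forall j, (0 < j)%N -> `|g j.+1 - g j| <= c) ->
  `|E (fun x => h (S x)) - al| <= c * \sum_i \sum_(j | nb i j) pr i * pr j.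
Proof.
move=> gh gc.
pose D i x := c * (hits I (nb i) x)%:R.
apply: le_trans (stein_bound g h al D gh _) _.
  by move=> i x; rewrite (hits_split i); exact: increments_le.
rewrite mulr_sumr; apply: ler_sum => i _.
by rewrite /D expectZ expect_hits mulrCA !mulr_sumr.
Qed.

(** Pairs of distinct indicators are never positively correlated: the
    expectation of the product is [0] for neighbours and factors otherwise.
    Hence the variance of a count is at most the sum of the variances, and so at
    most the mean. *)
Lemma variance_hits_le (B : pred J) (mu := \sum_(j | B j) pr j) :
  E (fun x => ((hits I B x)%:R - mu) ^+ 2) <= mu.
Proof.
have second : E (fun x => (hits I B x)%:R ^+ 2) <= mu + mu ^+ 2.
  have -> : E (fun x => (hits I B x)%:R ^+ 2) =
      \sum_(i | B i) \sum_(j | B j) E (fun x => (I i x)%:R * (I j x)%:R).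
    under [RHS]eq_bigr do rewrite -expect_sum.
    rewrite -expect_sum; apply: eq_expect => x.
    rewrite expr2 hitsE mulr_suml; apply: eq_bigr => i _.
    by rewrite mulr_sumr.
  have -> : mu + mu ^+ 2 = \sum_(i | B i) (pr i + \sum_(j | B j) pr i * pr j).
    rewrite big_split/= expr2.
    rewrite -[mu * mu]/((\sum_(j | B j) pr j) * mu) mulr_suml; congr (_ + _).
    by apply: eq_bigr => i _; rewrite mulr_sumr.
  apply: ler_sum => i Bi; rewrite (bigD1 i)//= [in leRHS](bigD1 i)//=.
  rewrite addrA lerD//.
    have -> : E (fun x => (I i x)%:R * (I i x)%:R) = pr i.
      by apply: eq_expect => x; case: (I i x); rewrite ?mulr1 ?mulr0.
    by rewrite lerDl mulr_ge0 ?indicator_expect_ge0.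
  apply: ler_sum => j /andP[Bj ji].
  have [nij|nij] := boolP (nb i j).
    rewrite (_ : E _ = 0) ?mulr_ge0 ?indicator_expect_ge0//.
    apply: big1 => x _; have := nb_exclusive dis i j x nij.
    rewrite eq_sym ji => /(_ isT).
    by case: (I i x); case: (I j x); rewrite //= ?mul0r !mulr0.
  have hits1 x : hits I (pred1 j) x = I j x by rewrite /hits big_pred1_eq.
  have := nb_indep dis i (pred1 j) (fun s => s%:R).
  rewrite /= => H; rewrite le_eqVlt; apply/orP; left; apply/eqP.
  under eq_expect do rewrite -hits1.
  rewrite H; last by move=> l /eqP ->.
  by congr (_ * _); apply: eq_expect => x; rewrite hits1.
have -> : E (fun x => ((hits I B x)%:R - mu) ^+ 2) =
    E (fun x => (hits I B x)%:R ^+ 2) - mu ^+ 2.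
  have -> : E (fun x => ((hits I B x)%:R - mu) ^+ 2) =
      E (fun x => (hits I B x)%:R ^+ 2 - (2 * mu * (hits I B x)%:R - mu ^+ 2)).
    by apply: eq_expect => x; ring.
  rewrite !expectB expectZ expect_hits expect_cst// -/mu; ring.
lra.
Qed.

(** Chebyshev's inequality for the lower tail. *)
Lemma hits_few_le (B : pred J) (v : nat) (mu := \sum_(j | B j) pr j) :
  v%:R < mu ->
  E (fun x => (hits I B x <= v)%:R) <= mu / (mu - v%:R) ^+ 2.
Proof.
move=> vmu; have d0 : 0 < mu - v%:R by rewrite subr_gt0.
rewrite ler_pdivlMr ?exprn_gt0// mulrC -expectZ.
apply: le_trans (variance_hits_le B); apply: le_expect => // x.
have [xv|_] := leqP (hits I B x) v; last by rewrite mulr0 sqr_ge0.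
rewrite mulr1 -(sqrrN (_ - mu)) opprB ler_pXn2r ?nnegrE ?(ltW d0)//.
  by rewrite lerB// ler_nat.
rewrite subr_ge0 (le_trans _ (ltW vmu))// ler_nat//.
Qed.

(** For a function [g] with values in [0, G1] that is at most [G2] beyond [v + 1],
    the difference [g (S + 1) - g (W_i + 1)] vanishes unless some neighbour [j]
    of [i] occurs. It is then at most [G2] if [W_i > v], and at most [G1]
    otherwise. In the latter case the runs far from both [i] and [j] number at
    most [v] too, and that event is independent of [I_j], which [W_i <= v] need
    not be. *)
Lemma chen_stein_half_line (g h : nat -> R) (al G1 G2 ka : R) (v : nat) :
  (forall s, (\sum_i pr i) * g s.+1 - s%:R * g s = h s - al) ->
  (forall j, 0 <= g j <= G1) ->
  (forall j, (v.+1 < j)%N -> g j <= G2) ->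
  (forall i j, nb i j -> E (fun x => (V i j x <= v)%:R) <= ka) ->
  `|E (fun x => h (S x)) - al| <=
    (G1 * ka + G2) * \sum_i \sum_(j | nb i j) pr i * pr j.
Proof.
move=> gh gG1 gG2 Vka.
have G10 : 0 <= G1 by have /andP[/le_trans] := gG1 0%N; apply.
have G20 : 0 <= G2.
  by apply: le_trans (gG2 v.+2 (leqnn _)); have /andP[] := gG1 v.+2.
pose D i x := \sum_(j | nb i j) (I j x)%:R * (G1 * (V i j x <= v)%:R + G2).
apply: le_trans (stein_bound g h al D gh _) _.
  move=> i x.
  have term0 j : 0 <= (I j x)%:R * (G1 * (V i j x <= v)%:R + G2).
    by rewrite mulr_ge0// addr_ge0// mulr_ge0.
  case: (boolP [exists j, nb i j && I j x]) => [/existsP[j /andP[nij Ij]]|none];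
      last first.
    have -> : S x = W i x.
      rewrite (hits_split i) /hits big1// => j nij.
      case: (boolP (I j x)) => // Ij.
      by case/negP: none; apply/existsP; exists j; rewrite nij.
    by rewrite subrr normr0 sumr_ge0.
  apply: (@le_trans _ _ ((I j x)%:R * (G1 * (V i j x <= v)%:R + G2)));
    last first.
    by rewrite /D (bigD1 j)//= lerDl sumr_ge0.
  rewrite Ij mul1r.
  have WS : (W i x <= S x)%N by rewrite (hits_split i) leq_addl.
  have [Wv|vW] := leqP (W i x) v.
    have -> : (V i j x <= v)%N.
      apply: leq_trans Wv; rewrite /hits big_mkcondr leq_sum// => l _.
      by case: ifP.
    have := gG1 (S x).+1; have := gG1 (W i x).+1.
    by rewrite ler_norml mulr1 => /andP[? ?] /andP[? ?]; apply/andP; split; lra.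
  have := gG2 (S x).+1; have := gG2 (W i x).+1.
  rewrite !ltnS vW (leq_trans vW WS) => /(_ isT) ? /(_ isT) ?.
  have /andP[? _] := gG1 (S x).+1; have /andP[? _] := gG1 (W i x).+1.
  have ? : 0 <= G1 * (V i j x <= v)%:R by rewrite mulr_ge0.
  by rewrite ler_norml; apply/andP; split; lra.
rewrite mulr_sumr; apply: ler_sum => i _.
rewrite /D expect_sum !mulr_sumr; apply: ler_sum => j nij.
rewrite (nb_indep dis j (fun l => ~~ nb i l && ~~ nb j l)
  (fun s => G1 * (s <= v)%:R + G2)); last by move=> l /andP[].
rewrite expectD expectZ expect_cst//.
rewrite [leRHS]mulrC mulrA; apply: ler_wpM2l.
  by rewrite mulr_ge0 ?indicator_expect_ge0.
by rewrite lerD2r ler_wpM2l ?Vka.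
Qed.

End chen_stein.

(** * Words of independent Bernoulli letters *)

Section bernoulli_words.
Context {R : realFieldType} (p : R) (n : nat).
Local Notation word := {ffun 'I_n -> bool}.
Implicit Types (x y z : word) (D : pred 'I_n).

Definition word_weight x : R := \prod_j (if x j then p else 1 - p).

Lemma expect_prod (F : 'I_n -> bool -> R) :
  expect word_weight (fun x => \prod_j F j (x j)) =
  \prod_j (p * F j true + (1 - p) * F j false).
Proof.
transitivity (\prod_(j < n) \sum_b (if b then p else 1 - p) * F j b).
  rewrite bigA_distr_bigA; apply: eq_bigr => x _.
  by rewrite /word_weight -big_split.
by apply: eq_bigr => j _; rewrite big_bool.
Qed.

Lemma word_weight_ge0 x : 0 <= p <= 1 -> 0 <= word_weight x.
Proof.
by move=> /andP[p0 p1]; apply: prodr_ge0 => j _; case: ifP; rewrite ?subr_ge0.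
Qed.

Lemma word_weight_sum1 : \sum_x word_weight x = 1.
Proof.
transitivity (expect word_weight (fun x => \prod_(j < n) 1)).
  by apply: eq_bigr => x _; rewrite big1 ?mulr1.
rewrite (expect_prod (fun _ _ => 1)) big1// => j _.
by rewrite !mulr1 addrC subrK.
Qed.

Definition depends_on {T : Type} D (f : word -> T) :=
  forall x y, (forall j, D j -> x j = y j) -> f x = f y.

(** The product of the expectations is a sum over pairs of words. Exchanging
    between the two words the letters outside [D] is an involution that
    preserves the product weight and brings both functions to the same word. *)
Lemma expect_indep D (f g : word -> R) :
  depends_on D f -> depends_on (predC D) g ->
  expect word_weight (fun x => f x * g x) =
  expect word_weight f * expect word_weight g.
Proof.
move=> fD gD.
pose mix x y : word := [ffun j => if D j then x j else y j].
pose swap (xy : word * word) := (mix xy.1 xy.2, mix xy.2 xy.1).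
have swapK : involutive swap.
  by move=> [x y]; rewrite /swap; congr pair; apply/ffunP => j;
    rewrite !ffunE; case: (D j).
rewrite [in RHS]/expect big_distrlr pair_big/=.
rewrite (reindex_inj (inv_inj swapK))/=.
have swap_weight x y :
    word_weight (mix x y) * word_weight (mix y x) = word_weight x * word_weight y.
  rewrite /word_weight -!big_split; apply: eq_bigr => j _.
  by rewrite !ffunE; case: (D j) => //=; rewrite mulrC.
transitivity (\sum_(xy : word * word)
    word_weight xy.1 * (f xy.1 * g xy.1) * word_weight xy.2).
  rewrite -(pair_big xpredT xpredT
    (fun x y => word_weight x * (f x * g x) * word_weight y))/=.
  apply: eq_bigr => x _.
  by rewrite -mulr_sumr word_weight_sum1 mulr1.
apply: eq_bigr => -[x y] _ /=.
rewrite (fD (mix x y) x); last by move=> j Dj; rewrite ffunE Dj.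
rewrite (gD (mix y x) x); last by move=> j /negbTE Dj; rewrite ffunE Dj.
have := swap_weight x y; set a := word_weight _; set b := word_weight (mix y x).
by move=> e; rewrite mulrACA e; ring.
Qed.

End bernoulli_words.

(** * Runs in a word *)

Section runs_of_successes.
Implicit Types (y z : nat -> bool) (i j k m : nat).

Definition is_run k i y : bool :=
  ~~ (if i is j.+1 then y j else false) && [forall l : 'I_k, y (i + l)%N].

Lemma eq_is_run k i y z :
  (forall m, (i <= m.+1)%N -> (m < i + k)%N -> y m = z m) ->
  is_run k i y = is_run k i z.
Proof.
move=> yz; rewrite /is_run; congr (~~ _ && _).
  by case: i yz => // i yz; rewrite yz// addSn ltnS leq_addr.
apply: eq_forallb => l; apply: yz; first by rewrite leqW ?leq_addr.
by rewrite ltn_add2l.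
Qed.

(** The failure required just before [j] contradicts the success that the run
    from [i] requires there. *)
Lemma is_run_exclusive k i j y : (i < j <= i + k)%N ->
  ~~ (is_run k i y && is_run k j y).
Proof.
case: j => [//|j] /andP[]; rewrite ltnS => ij jik.
apply/negP => /andP[/andP[_ /forallP runi] /andP[/negP nyj _]]; apply: nyj.
have lk : (j - i < k)%N by rewrite ltn_subLR.
by have := runi (Ordinal lk); rewrite /= subnKC.
Qed.

End runs_of_successes.

Section runs_in_words.
Context {R : realFieldType} {p : R} {n k : nat} (kn : (k <= n)%N).
Context (p0 : 0 < p) (p1 : p <= 1).
Local Notation word := {ffun 'I_n -> bool}.
Local Notation start := 'I_(n - k).+1.
Implicit Types (x : word) (i j : start).

(** A word is continued by failures, so that runs are defined for it as for a
    sequence. *)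
Definition letters x (m : nat) : bool := if insub m is Some j then x j else false.

Lemma letters_ord x (m : 'I_n) : letters x m = x m.
Proof. by rewrite /letters valK. Qed.

Definition word_run i x := is_run k i (letters x).

Definition overlap i j := (i <= j + k)%N && (j <= i + k)%N.

Lemma start_lt i m : (m < i + k)%N -> (m < n)%N.
Proof.
move=> mik; apply: leq_trans mik _; have := ltn_ord i.
by rewrite ltnS leq_subRL// addnC.
Qed.

Lemma word_run_depends (D : pred 'I_n) i :
  (forall m : 'I_n, (i <= m.+1)%N -> (m < i + k)%N -> D m) ->
  depends_on n D (word_run i).
Proof.
move=> iD x y xy; apply: eq_is_run => m im mik.
have mn : (m < n)%N := start_lt i m mik.
by rewrite -[m]/(val (Ordinal mn)) !letters_ord xy// iD.
Qed.

Lemma word_runs_dissociated :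
  exclusive_dissociated (word_weight p n) word_run overlap.
Proof.
split.
- by move=> x; rewrite word_weight_ge0// ltW.
- exact: word_weight_sum1.
- by move=> i; rewrite /overlap leq_addr.
- move=> i j x /andP[ij ji]; rewrite neq_ltn => /orP[lt|lt].
    by apply: is_run_exclusive; rewrite lt.
  by rewrite andbC; apply: is_run_exclusive; rewrite lt.
- move=> i B f Bi.
  pose D : pred 'I_n := fun m => (i <= m.+1)%N && (m < i + k)%N.
  apply: (expect_indep p n D).
    by move=> x y xy; congr (_%:R); congr nat_of_bool;
      apply: word_run_depends xy => m im mik; apply/andP.
  move=> x y xy; congr f; apply: eq_bigr => j Bj; congr nat_of_bool.
  apply: word_run_depends xy => m jm mjk; apply/negP => /andP[im mik].
  have /negP := Bi j Bj; apply; apply/andP; split.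
    by rewrite (leq_trans im).
  by rewrite (leq_trans jm).
Qed.

(** A run from [i] prescribes [k] successes and, unless [i = 0], one failure; it
    is written as a product of conditions on single letters. *)
Lemma word_run_prob i :
  expect (word_weight p n) (fun x => (word_run i x)%:R) =
  p ^+ k * (1 - p) ^+ (0 < i)%N.
Proof.
pose F (m : nat) (b : bool) : bool :=
  if (i <= m < i + k)%N then b else if m.+1 == i then ~~ b else true.
have runE x : word_run i x = [forall m : 'I_n, F m (x m)].
  apply/idP/forallP => [/andP[prev /forallP run] m|H].
    rewrite /F; case: ifP => [/andP[im mik]|_].
      have lk : (m - i < k)%N by rewrite ltn_subLR.
      by have := run (Ordinal lk); rewrite /= subnKC// letters_ord.
    by case: eqP => // im; move: prev; rewrite -im letters_ord.
  apply/andP; split.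
    case iE: (i : nat) => [//|i'].
    have i'n : (i' < n)%N.
      by have := ltn_ord i; rewrite iE ltnS => /leq_trans; apply; exact: leq_subr.
    have := H (Ordinal i'n); rewrite /F/= iE ltnn/= eqxx => nx.
    by rewrite -[i' in letters x i']/(val (Ordinal i'n)) letters_ord nx.
  apply/forallP => l.
  have mn : (i + l < n)%N by apply: (start_lt i); rewrite ltn_add2l.
  have := H (Ordinal mn); rewrite /F/= leq_addr ltn_add2l ltn_ord/=.
  by rewrite -[(i + l)%N]/(val (Ordinal mn)) letters_ord.
have -> : expect (word_weight p n) (fun x => (word_run i x)%:R) =
    expect (word_weight p n) (fun x => \prod_(m < n) (F m (x m))%:R).
  apply: eq_expect => x; rewrite runE.
  case: (boolP [forall m, _]) => [/forallP H|].
    by rewrite big1// => m _; rewrite H.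
  rewrite negb_forall => /existsP[m /negbTE Fm].
  by rewrite (bigD1 m)//= Fm mul0r.
rewrite (expect_prod p n (fun m b => (F m b)%:R)).
transitivity (\prod_(m < n) (if (i <= m < i + k)%N then p else 1) *
              \prod_(m < n) (if m.+1 == i then 1 - p else 1)).
  rewrite -big_split; apply: eq_bigr => m _; rewrite /F.
  case: ifP => [/andP[im _]|_]; last by case: eqP => _ /=; ring.
  rewrite gtn_eqF/=; first by ring.
  by rewrite ltnS.
congr (_ * _).
  have ikn : (i + k <= n)%N.
    by have := ltn_ord i; rewrite ltnS leq_subRL// addnC.
  rewrite -big_mkcond/=.
  have := prodr_const_nat i (i + k) p; rewrite addKn => <-.
  rewrite (big_nat_widen i (i + k) n)// big_geq_mkord/=.
  by apply: eq_bigl => m; rewrite andbC.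
case: (i : nat) (ltn_ord i) => [|i'] lt; first by rewrite big1// => m _.
rewrite -big_mkcond/=.
have i'n : (i' < n)%N by rewrite ltnS in lt; exact: leq_trans lt (leq_subr _ _).
by rewrite (big_pred1 (Ordinal i'n)).
Qed.

Lemma word_run_prob_le i :
  expect (word_weight p n) (fun x => (word_run i x)%:R) <= p ^+ k.
Proof.
rewrite word_run_prob ler_piMr ?exprn_ge0 ?(ltW p0)//.
by rewrite exprn_ile1// ?subr_ge0// lerBlDr lerDl ltW.
Qed.

Lemma card_overlap i : (#|overlap i| <= 2 * k + 1)%N.
Proof.
rewrite cardE -(size_map val) -[leqRHS](size_iota (i - k)).
apply: uniq_leq_size.
  by rewrite map_inj_uniq ?enum_uniq//; exact: val_inj.
move=> m /mapP[j]; rewrite mem_enum => /andP[ij ji] ->.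
by move: ij ji; rewrite mem_iota/=; lia.
Qed.

Lemma overlap_prob_le i :
  \sum_(j | overlap i j) expect (word_weight p n) (fun x => (word_run j x)%:R)
    <= (2 * k + 1)%:R * p ^+ k.
Proof.
apply: le_trans (_ : \sum_(j | overlap i j) p ^+ k <= _).
  by apply: ler_sum => j _; exact: word_run_prob_le.
rewrite sumr_const mulr_natl; apply: ler_wpMn2l (card_overlap i).
by rewrite exprn_ge0 ?(ltW p0).
Qed.

End runs_in_words.
Arguments word_run {n} k i x.

(** * From the probability space to words *)

Section transfer.
Context {R : realType} {d : measure_display} {T : measurableType d}.
Context {P : probability T R} {p : R} {X : nat -> {RV P >-> bool}}.
Context (p0 : 0 <= p) (p1 : p <= 1).
Context (hbern : forall (j : nat) (A : set bool),
  distribution P (X j) A = bernoulli_prob p A).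
Context (hindep : mutually_independent X).
Context (n : nat).
Local Notation word := {ffun 'I_n -> bool}.
Implicit Types (x : word).

Definition observed (t : T) : word := [ffun j => X (val j) t].

Lemma letter_law j (b : bool) :
  P (X j @^-1` [set b]) = (if b then p else 1 - p)%:E.
Proof.
rewrite -[LHS]/(distribution P (X j) [set b]) hbern bernoulli_probE ?p0//.
rewrite !diracE; case: b.
  by rewrite mem_set// memNset//= mule1 mule0 adde0.
by rewrite memNset// mem_set//= mule1 mule0 add0e.
Qed.

Let cylinderE x : observed @^-1` [set x] =
  \bigcap_(j in [set` [fset j in iota 0 n]%fset]) (X j @^-1` [set letters x j]).
Proof.
apply/seteqP; split=> t /=.
  move=> <- j /=; rewrite !inE mem_iota add0n /= => jn.
  by rewrite -[j]/(val (Ordinal jn)) letters_ord ffunE.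
move=> H; apply/ffunP => j; rewrite ffunE -letters_ord.
by apply: H; rewrite /= !inE mem_iota add0n ltn_ord.
Qed.

Lemma measurable_cylinder x : measurable (observed @^-1` [set x]).
Proof.
rewrite cylinderE; apply: fin_bigcap_measurable => // j _.
exact: measurable_funPTI.
Qed.

Lemma cylinder_law x : P (observed @^-1` [set x]) = (word_weight p n x)%:E.
Proof.
rewrite cylinderE (hindep _ (fun j => [set letters x j]))//.
rewrite (perm_big (iota 0 n)); last first.
  by apply: uniq_perm; rewrite ?fset_uniq ?iota_uniq// => j; rewrite !inE.
rewrite -[X in iota _ X]subn0 -/(index_iota 0 n) big_mkord /word_weight -prodEFin.
by apply: eq_bigr => j _; rewrite letter_law letters_ord.
Qed.

(** The sets of sample points that show a given word partition the space, so an
    integral of a function of the word is a finite sum. *)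
Lemma integral_observed (f : word -> R) : (forall x, 0 <= f x) ->
  (\int[P]_t (f (observed t))%:E = (expect (word_weight p n) f)%:E)%E.
Proof.
move=> f0.
have fE t : (f (observed t))%:E =
    (\sum_x (f x)%:E * (\1_(observed @^-1` [set x]) t)%:E)%E.
  rewrite (bigD1 (observed t))//= indicE mem_set// mule1 big1 ?adde0// => x xt.
  rewrite indicE memNset ?mule0//= => /= tx; move: xt.
  by rewrite tx eqxx.
under eq_integral do rewrite fE.
rewrite ge0_integral_sum//; last first.
- by move=> x t _; rewrite mule_ge0 ?lee_fin.
- move=> x; apply: measurable_funeM; apply/measurable_EFinP.
  exact/measurable_indic/measurable_cylinder.
rewrite /expect -sumEFin; apply: eq_bigr => x _.
rewrite ge0_integralZl_EFin//; last first.
  by apply/measurable_EFinP/measurable_indic/measurable_cylinder.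
rewrite integral_indic//; last exact: measurable_cylinder.
by rewrite setIT mulrC EFinM; congr (_ * _)%E; exact: cylinder_law.
Qed.

Context {k : nat} (kn : (k <= n)%N).

Lemma run_count_observed t :
  run_count X n k t = hits (word_run k) predT (observed t).
Proof.
rewrite /run_count big_mkord; apply: eq_bigr => i _; congr nat_of_bool.
transitivity (is_run k i (fun j => X j t)); first by case: (i : nat).
apply: eq_is_run => m _ mik.
by rewrite -[m in RHS]/(val (Ordinal (start_lt kn i m mik))) letters_ord ffunE.
Qed.

Lemma run_count_law (A : set nat) :
  P (run_count X n k @^-1` A) =
  (expect (word_weight p n) (fun x => (hits (word_run k) predT x \in A)%:R))%:E.
Proof.
have mA : measurable (run_count X n k @^-1` A).
  by rewrite -[X in measurable X]setTI; exact: measurable_run_count.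
rewrite -[in LHS](setIT (_ @^-1` _)) -integral_indic// -integral_observed//.
by apply: eq_integral => t _; rewrite indicE -run_count_observed.
Qed.

Lemma run_mean_observed : run_mean X n k =
  expect (word_weight p n) (fun x => (hits (word_run k) predT x)%:R).
Proof.
rewrite /run_mean unlock.
under eq_integral do rewrite run_count_observed.
by rewrite (integral_observed (fun x => (hits (word_run k) predT x)%:R)).
Qed.

End transfer.

(** * Poisson approximation of the number of runs *)

Section run_count_approximation.
Context {R : realType} {p : R} {n k : nat}.
Context (kn : (k <= n)%N) (p0 : 0 < p) (p2 : p <= 1 / 2).

Local Notation E := (expect (word_weight p n)).
Local Notation S := (hits (word_run (n := n) k) predT).
Local Notation pr i := (E (fun x => (word_run k i x)%:R)).

Let p1 : p <= 1.
Proof. by move: p2; lra. Qed.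

Let dis := word_runs_dissociated kn p0 p1.

Definition word_run_mean : R := E (fun x => (S x)%:R).
Local Notation lam := word_run_mean.

Let lamE : lam = \sum_i pr i.
Proof. exact: expect_hits. Qed.

Let pr_ge0 i : 0 <= pr i.
Proof. exact: indicator_expect_ge0 dis i. Qed.

Let pk0 : 0 < p ^+ k.
Proof. exact: exprn_gt0. Qed.

Lemma word_run_mean_le : lam <= (n - k).+1%:R * p ^+ k.
Proof.
rewrite lamE; apply: le_trans (ler_sum _ _) _.
  by move=> i _; exact: word_run_prob_le kn p0 p1 i.
by rewrite sumr_const card_ord mulr_natl.
Qed.

(** A starting point other than [0] costs the factor [1 - p >= 1 / 2]. *)
Lemma word_run_mean_ge : (n - k).+1%:R * p ^+ k <= 2 * lam.
Proof.
have prob_ge (i : 'I_(n - k).+1) : true -> p ^+ k / 2 <= pr i.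
  move=> _; rewrite (word_run_prob kn) ler_pM2l//.
  by case: (0 < i)%N; rewrite ?expr1 ?expr0; move: p2; lra.
have : \sum_(i < (n - k).+1) p ^+ k / 2 <= lam by rewrite lamE ler_sum.
rewrite sumr_const card_ord -[_ *+ (n - k).+1]mulr_natl mulrA ler_pdivrMr//.
by rewrite [leRHS]mulrC.
Qed.

Lemma word_run_mean_gt0 : 0 < lam.
Proof.
rewrite -(pmulr_rgt0 lam (ltr0Sn R 1)).
by apply: lt_le_trans word_run_mean_ge; rewrite mulr_gt0.
Qed.

Let lam0 := word_run_mean_gt0.

Let overlapping_pairs_le :
  \sum_i \sum_(j | overlap i j) pr i * pr j <= lam * ((2 * k + 1)%:R * p ^+ k).
Proof.
rewrite lamE mulr_suml; apply: ler_sum => i _; rewrite -mulr_sumr.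
by apply: ler_wpM2l; [exact: pr_ge0|exact: overlap_prob_le].
Qed.

Lemma run_count_poisson (A : set nat) :
  `|E (fun x => (S x \in A)%:R) - fine (poisson_law lam A)| <=
  (2 * k + 1)%:R * Num.min 1 lam * p ^+ k.
Proof.
have := chen_stein_uniform dis (stein_solution lam A)
  (fun s => (s \in A)%:R) (fine (poisson_law lam A)) (Num.min 1 lam^-1).
rewrite -lamE => /(_ (fun s => stein_equation lam A s lam0)
  (fun j => stein_increment lam A j lam0)) /le_trans; apply.
apply: le_trans (ler_wpM2l _ overlapping_pairs_le) _.
  by rewrite le_min ler01 invr_ge0 ltW.
have minE : Num.min 1 lam^-1 * lam = Num.min 1 lam.
  by rewrite minr_pMl ?(ltW lam0)// mul1r mulVf ?gt_eqF// minC.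
rewrite !mulrA minE.
by rewrite [_ * (2 * k + 1)%:R]mulrC.
Qed.

(** The hypotheses keep [v], and the mean number of runs near two given
    positions, small compared to [lam]. The number of remaining runs then has a
    mean that exceeds [v] by at least [lam / 2], so that it is at most [v] with
    probability at most [4 / lam]. *)
Lemma run_count_poisson_half_line (v : nat) :
  8 * v%:R <= lam -> 2 * ((2 * k + 1)%:R * p ^+ k) <= 3 / 10 * lam ->
  `|E (fun x => (S x <= v)%N%:R) -
    fine (poisson_law lam [set j : nat | (j <= v)%N])| <=
  3 * (v + 2)%:R * ((2 * k + 1)%:R * p ^+ k) / lam.
Proof.
move=> v8 few; set A := [set j | _].
pose g := stein_solution lam A.
pose G1 := 8 / (7 * lam); pose G2 := v.+1%:R * 8 / (7 * lam ^+ 2).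
have peak : g v.+1 <= G1.
  have := stein_half_line_peak_le lam v lam0; rewrite -/A -/g => h.
  rewrite /G1 ler_pdivlMr ?mulr_gt0//.
  have : 7 * lam * g v.+1 <= 8 * ((lam - v%:R) * g v.+1).
    rewrite mulrA ler_wpM2r ?stein_half_line_ge0//; lra.
  lra.
have beyond : g v.+2 <= G2.
  have := stein_half_line_beyond_le lam v lam0; rewrite -/A -/g => h.
  rewrite -(ler_pM2l lam0); apply: le_trans h _.
  apply: le_trans (ler_wpM2l (ler0n _ _) peak) _.
  rewrite le_eqVlt; apply/orP; left; apply/eqP; rewrite /G1 /G2.
  by field; rewrite gt_eqF.
have remaining i j (B := fun l => ~~ overlap i l && ~~ overlap j l) :
    E (fun x => (hits (word_run k) B x <= v)%:R) <= 4 / lam.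
  pose mu := \sum_(l | B l) pr l.
  have mu_le : mu <= lam.
    by rewrite lamE /mu big_mkcond ler_sum// => l _; case: ifP.
  have mu_ge : 7 / 10 * lam <= mu.
    have : lam <= mu + \sum_(l | overlap i l) pr l + \sum_(l | overlap j l) pr l.
      rewrite lamE /mu (big_mkcond B) (big_mkcond (overlap i)).
      rewrite (big_mkcond (overlap j)) -!big_split ler_sum// => l _.
      by rewrite /B; do 2 case: (overlap _ l) => /=; have := pr_ge0 l; lra.
    have := overlap_prob_le kn p0 p1 i; have := overlap_prob_le kn p0 p1 j.
    by lra.
  have lam_gt0 := lam0.
  have vmu : lam / 2 <= mu - v%:R by lra.
  apply: le_trans (hits_few_le dis B v _) _; rewrite -/mu; first by lra.
  rewrite ler_pdivrMr ?exprn_gt0//; last by lra.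
  have : (lam / 2) ^+ 2 <= (mu - v%:R) ^+ 2.
    by rewrite ler_pXn2r ?nnegrE//; lra.
  move=> /(ler_wpM2l (_ : 0 <= 4 / lam)) h; apply: le_trans (h _).
    have -> : 4 / lam * (lam / 2) ^+ 2 = lam by field; rewrite gt_eqF.
    exact: mu_le.
  by rewrite divr_ge0// ltW.
have := chen_stein_half_line dis g
  (fun s => (s \in A)%:R) (fine (poisson_law lam A)) G1 G2 (4 / lam) v.
rewrite -lamE => /(_ (fun s => stein_equation lam A s lam0)) H.
have {}H := H _ _ (fun i j _ => remaining i j).
have inA s : (s \in A) = (s <= v)%N.
  by apply/idP/idP => [/set_mem//|sv]; apply/mem_set.
have -> : E (fun x => (S x <= v)%N%:R) = E (fun x => (S x \in A)%:R).
  by apply: eq_expect => x; rewrite inA.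
apply: le_trans (H _ _) _.
- move=> j; rewrite stein_half_line_ge0//=.
  exact: le_trans (stein_half_line_le_peak lam v lam0 j) peak.
- move=> j vj.
  exact: le_trans (stein_half_line_le_beyond lam v lam0 j vj) beyond.
have G0 : 0 <= G1 * (4 / lam) + G2.
  by rewrite /G1 /G2 addr_ge0// ?mulr_ge0// ?invr_ge0 ?mulr_ge0 ?exprn_ge0// ltW.
apply: le_trans (ler_wpM2l G0 overlapping_pairs_le) _.
set c := _ * p ^+ k.
have c0 : 0 <= c by rewrite mulr_ge0// ltW.
have -> : (G1 * (4 / lam) + G2) * (lam * c) =
    (32 / 7 + v.+1%:R * (8 / 7)) * c / lam.
  by rewrite /G1 /G2; field; rewrite gt_eqF.
rewrite ler_wpM2r ?invr_ge0 ?(ltW lam0)// ler_wpM2r//.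
by rewrite -natr1 natrD; have := ler0n R v; lra.
Qed.

End run_count_approximation.

(** * The logarithmic rate *)

Section logarithmic_estimates.
Context {R : realType}.
Implicit Types (n k : nat).

Lemma ln2_ge_half : 1 / 2 <= ln (2 : R).
Proof.
have := @le_ln1Dx R (- (1 / 2)).
rewrite (_ : 1 + - (1 / 2) = 2^-1 :> R); last by field.
rewrite lnV ?posrE// => /(_ _) h.
by have := h; lra.
Qed.

Lemma ln_nat_ge_half n : (2 <= n)%N -> 1 / 2 <= ln (n%:R : R).
Proof.
move=> n2; apply: le_trans ln2_ge_half _.
by rewrite ler_ln ?posrE ?ltr0n ?ler_nat// (leq_trans _ n2).
Qed.

(** The factor [2] stands for [1 / ln 2], which is smaller. *)
Lemma exponent_le_ln n k c : (0 < n)%N -> (2 ^ k <= n ^ c)%N ->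
  k%:R <= 2 * c%:R * ln (n%:R : R).
Proof.
move=> n0; rewrite -(ler_nat R) => h.
have : ln ((2 ^ k)%N%:R : R) <= ln ((n ^ c)%N%:R).
  by rewrite ler_ln// posrE ltr0n expn_gt0// n0.
rewrite !natrX !lnXn ?ltr0n// -[_ *+ k]mulr_natl -[_ *+ c]mulr_natl => hk.
have := ler_wpM2l (ler0n R k) ln2_ge_half.
by move: hk; rewrite -[2%:R]/(2 : R); lra.
Qed.

Lemma sqr_odd_le_exp2 k : ((2 * k + 1) ^ 2 <= 9 * 2 ^ k)%N.
Proof.
case: k => [//|]; case=> [//|]; elim=> [//|k IH].
rewrite [(2 ^ _.+3)%N]expnS mulnCA; apply: leq_trans (leq_mul (leqnn 2) IH).
by rewrite -!mulnn; nia.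
Qed.

(** For [k] beyond [2 * log2 n] the total variation bound is already of order
    [1/n]: half of the decay of [2^-k] absorbs the factor [2k + 1], the other
    half is at most [1/n]. *)
Lemma overlap_decay n k (p : R) : (0 < n)%N -> (n ^ 2 < 2 ^ k)%N ->
  0 < p -> p <= 1 / 2 -> (2 * k + 1)%:R * p ^+ k <= 3 / n%:R.
Proof.
move=> n0 nk p0 p2.
have n0R : 0 < n%:R :> R by rewrite ltr0n.
have pk : p ^+ k <= (2 ^ k)%N%:R^-1.
  have p2' : p <= 2^-1 by move: p2; lra.
  by rewrite natrX -exprVn lerXn2r ?nnegrE ?(ltW p0).
apply: le_trans (ler_wpM2l (ler0n _ _) pk) _.
rewrite ler_pdivrMr ?ltr0n ?expn_gt0// mulrAC ler_pdivlMr//.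
rewrite -!natrM ler_nat -leq_sqr.
have := sqr_odd_le_exp2 k; rewrite !expnMn => h.
apply: leq_trans (leq_mul h (ltnW nk)) _.
by rewrite -mulnA -expnD addnn -muln2 expnM.
Qed.

End logarithmic_estimates.

Section half_line_rate.
Context {R : realType} {p : R} {n k : nat}.
Context (n2 : (2 <= n)%N) (k0 : (0 < k)%N) (kn : (k <= n)%N).
Context (p0 : 0 < p) (p2 : p <= 1 / 2).
Local Notation E := (expect (word_weight p n)).
Local Notation S := (hits (word_run (n := n) k) predT).
Local Notation lam := (word_run_mean (p := p) (n := n) (k := k)).

(** The target is trivial unless [n] exceeds [40 * (v + 2)^2 * ln n], and follows
    from [overlap_decay] for large [k]. In the remaining range [k <= 4 * ln n], so
    [n * p^k <= 4 * lam], and the size of [lam] relative to [(v + 2)^2] decides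
    which of the two Poisson approximations applies. The constant [40] is
    reached when [lam <= (v + 2)^2], as [10 * ln n] for [2k + 1] times [4]. *)
Lemma run_count_half_line_rate (v : nat) :
  `|E (fun x => (S x <= v)%N%:R) -
    fine (poisson_law lam [set j : nat | (j <= v)%N])|
  <= 40 * (v + 2)%:R ^+ 2 * (ln n%:R / n%:R).
Proof.
have n_gt0 : (0 < n)%N by exact: leq_trans n2.
have n0 : 0 < n%:R :> R by rewrite ltr0n.
set L : R := ln n%:R; have L2 : 1 / 2 <= L by exact: ln_nat_ge_half.
set q := p ^+ k; set D : R := `|_|.
set V : R := (v + 2)%:R.
have V2 : 2 <= V by rewrite ler_nat leq_addl.
have q0 : 0 < q by exact: exprn_gt0.
set c : R := (2 * k + 1)%:R.
have c0 : 0 <= c by exact: ler0n.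
have lam0 : 0 < lam := word_run_mean_gt0 kn p0 p2.
rewrite mulrA ler_pdivlMr//.
have E01 : 0 <= E (fun x => (S x <= v)%N%:R) <= 1.
  have w0 (x : {ffun 'I_n -> bool}) : 0 <= word_weight p n x.
    by apply: word_weight_ge0; move: p0 p2; lra.
  apply/andP; split; first by apply: sumr_ge0 => x _; rewrite mulr_ge0.
  rewrite -[leRHS](expect_cst (word_weight p n)) ?word_weight_sum1//.
  by apply: le_expect => // x; rewrite lern1 leq_b1.
have M01 : 0 <= fine (poisson_law lam [set j : nat | (j <= v)%N]) <= 1.
  rewrite fine_ge0//= -[leRHS]/(fine (1%:E : \bar R)).
  by rewrite fine_le ?fin_num_measure// probability_le1.
have D1 : D <= 1.
  by rewrite ler_norml; move: E01 M01; lra.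
have uniform : D <= c * Num.min 1 lam * q.
  have := run_count_poisson kn p0 p2 [set j : nat | (j <= v)%N].
  congr (`|_ - _| <= _); apply: eq_expect => x; congr (nat_of_bool _)%:R.
  by apply/idP/idP => [/set_mem//|sv]; apply/mem_set.
have uniform1 : D <= c * q.
  apply: le_trans uniform _; rewrite -mulrA ler_wpM2l//.
  by rewrite ler_piMl ?(ltW q0)// ge_min lexx.
have [small|large] := leP n%:R (40 * V ^+ 2 * L).
  by apply: le_trans small; rewrite ler_piMl// ltW.
have V4 : 4 * L <= V ^+ 2 * L.
  rewrite ler_wpM2r//; first by lra.
  by rewrite expr2; apply: le_trans (ler_pM _ _ V2 V2); rewrite ?ler0n//; lra.
have [kbig|kn2] := ltnP (n ^ 2) (2 ^ k).
  have := le_trans uniform1 (overlap_decay n k p n_gt0 kbig p0 p2).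
  by rewrite ler_pdivlMr//; lra.
have k4 : k%:R <= 4 * L.
  have := exponent_le_ln (R := R) n k 2 n_gt0 kn2; rewrite -/L.
  by rewrite -natrM.
have cE : c = 2 * k%:R + 1 by rewrite /c natrD natrM.
have half_n : n%:R / 2 <= (n - k).+1%:R :> R.
  rewrite -(natr1 (n - k)) natrB//; lra.
have qn : n%:R * q <= 4 * lam.
  have := word_run_mean_ge kn p0 p2; rewrite -/q => h.
  have := ler_wpM2r (ltW q0) half_n; lra.
have [lamV|lamV] := leP lam (V ^+ 2).
  have c10 : c <= 10 * L by lra.
  apply: le_trans (ler_wpM2r (ltW n0) uniform1) _.
  rewrite -[leLHS]mulrA [q * _]mulrC.
  apply: le_trans (ler_wpM2l c0 qn) _.
  apply: le_trans (ler_wpM2r _ c10) _; first by rewrite mulr_ge0// ltW.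
  have L40 : 0 <= 40 * L by lra.
  have := ler_wpM2l L40 lamV; lra.
have nq : lam <= n%:R * q.
  apply: le_trans (word_run_mean_le kn p0 p2) _.
  by rewrite ler_wpM2r ?(ltW q0)// ler_nat ltn_subrL k0.
(* A mean above 4 forces [p^k] above [1/n], which sharpens the bound on [k]. *)
have c6 : c <= 6 * L.
  have kn1 : (2 ^ k <= n ^ 1)%N.
    rewrite expn1 -(ler_nat R) natrX.
    have : 1 <= n%:R * q.
      by apply: le_trans nq; move: V4 L2 lamV V2; nra.
    move=> h; apply: le_trans (ler_peMr _ h) _; first by rewrite exprn_ge0.
    rewrite mulrCA ler_piMr ?(ltW n0)// /q -exprMn exprn_ile1//.
      by rewrite mulr_ge0// ltW.
    by move: p2; lra.
  have := exponent_le_ln (R := R) n k 1 n_gt0 kn1; rewrite -/L.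
  by rewrite mulr1; lra.
have cqn : c * q * n%:R <= 24 * L * lam.
  rewrite -[leLHS]mulrA [q * _]mulrC; apply: le_trans (ler_wpM2l c0 qn) _.
  have := ler_wpM2r (ltW lam0) c6; lra.
have few : 2 * (c * q) <= 3 / 10 * lam.
  rewrite -(ler_pM2r n0).
  have : L * lam <= n%:R / 160 * lam.
    by rewrite ler_wpM2r ?(ltW lam0)//; lra.
  lra.
have v8 : 8 * v%:R <= lam.
  have vE : V = v%:R + 2 by rewrite /V natrD.
  have := sqr_ge0 (V - 4); rewrite sqrrB; move: lamV; rewrite vE !expr2; lra.
have := run_count_poisson_half_line kn p0 p2 v v8 few.
rewrite -/D -/V -/q -/c ler_pdivlMr// => DlV.
rewrite -(ler_pM2r lam0) mulrAC.
apply: le_trans (ler_wpM2r (ltW n0) DlV) _.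
rewrite -[leLHS]mulrA; apply: le_trans (ler_wpM2l _ cqn) _; first by lra.
have : V * 2 * (L * lam) <= V * V * (L * lam).
  rewrite ler_wpM2r ?mulr_ge0 ?(ltW lam0)//; first by lra.
  by rewrite ler_wpM2l//; lra.
have : 0 <= V * (L * lam).
  by rewrite !mulr_ge0 ?(ltW lam0)//; lra.
rewrite expr2; lra.
Qed.

End half_line_rate.

(** * Runs in a Bernoulli sequence *)

Theorem theorem3p5 (R : realType) (d : measure_display) (T : measurableType d)
    (P : probability T R) (p : R) (X : nat -> {RV P >-> bool})
    (hp0 : 0 < p) (hp : p <= 1 / 2)
    (hbern : forall (j : nat) (A : set bool),
      distribution P (X j) A = bernoulli_prob p A)
    (hindep : mutually_independent X) :
  (forall k n : nat, (1 <= k)%N -> (k <= n)%N ->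
    dTV (distribution P (run_count X n k)) (poisson_law (run_mean X n k))
      <= (2 * k + 1)%:R * Num.min 1 (run_mean X n k) * p ^+ k) /\
  (forall v n : nat, (2 <= n)%N ->
    \big[Num.max/0]_(1 <= k < n.+1)
      `| fine (P [set w | (run_count X n k w <= v)%N]) -
         fine (poisson_law (run_mean X n k) [set j : nat | (j <= v)%N]) |
      <= 40 * (v + 2)%:R ^+ 2 * (ln n%:R / n%:R)).
Proof.
have p1 : p <= 1 by move: hp; lra.
have mean k n (kn : (k <= n)%N) :=
  run_mean_observed (ltW hp0) p1 hbern hindep n kn.
have law k n (kn : (k <= n)%N) :=
  run_count_law (ltW hp0) p1 hbern hindep n kn.
split=> [k n k1 kn|v n n2].
  apply: ge_sup; first by eexists; exists set0.
  move=> _ [A _ <-]; rewrite mean//.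
  have lawA := congr1 fine (law k n kn A); rewrite /= in lawA.
  by have := run_count_poisson kn hp0 hp A; rewrite -lawA; exact.
rewrite big_nat; apply: bigmax_le => [|k /andP[k1 kn]].
  rewrite !mulr_ge0// ?exprn_ge0// ?invr_ge0// ln_ge0//.
  by rewrite ler1n (leq_trans _ n2).
rewrite mean// (law k n kn [set j | (j <= v)%N])/=.
have -> : expect (word_weight p n)
    (fun x => (hits (word_run k) predT x \in [set j | (j <= v)%N])%:R) =
  expect (word_weight p n) (fun x => (hits (word_run k) predT x <= v)%N%:R).
  apply: eq_expect => x; congr (nat_of_bool _)%:R.
  by apply/idP/idP => [/set_mem//|xv]; apply/mem_set.
exact: run_count_half_line_rate.
Qed.
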